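(* Let $A=(a_{i_1i_2})$, $B=(b_{j_1j_2})$ and $C=(c_{k_1k_2})$ be symmetric real matrices of sizes $n\times n$, $m\times m$ and $p\times p$, respectively. Then for every real two-dimensional array $x=(x_{ij})_{1\le i\le n,\,1\le j\le m}$, $$\sum_{i_1,i_2=1}^{n}\ \sum_{j_1,j_2=1}^{m} a_{i_1i_2}\,b_{j_1j_2}\,x_{i_1j_1}x_{i_2j_2}=\bar{x}^T(B\otimes A)\bar{x},$$ and for every real three-dimensional array $x=(x_{ijk})_{1\le i\le n,\,1\le j\le m,\,1\le k\le p}$, $$\sum_{i_1,i_2=1}^{n}\ \sum_{j_1,j_2=1}^{m}\ \sum_{k_1,k_2=1}^{p} a_{i_1i_2}\,b_{j_1j_2}\,c_{k_1k_2}\,x_{i_1j_1k_1}x_{i_2j_2k_2}=\bar{x}^T(C\otimes B\otimes A)\bar{x}.$$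
   Context: $\bar{x}$ denotes the column vector obtained from a multidimensional array $x$ by Fortran-style (column-major) ordering, in which the first index varies fastest: for a two-dimensional array, $x_{ij}$ is the entry of $\bar x$ in position $n(j-1)+i$; for a three-dimensional array, $x_{ijk}$ is the entry of $\bar x$ in position $nm(k-1)+n(j-1)+i$. For an $m\times n$ matrix $A$ and a $p\times q$ matrix $B$, the Kronecker product $A\otimes B$ is the $mp\times nq$ block matrix whose $(i,j)$ block is $a_{ij}B$; that is, the element $a_{ij}b_{kl}$ is in row $p(i-1)+k$ and column $q(j-1)+l$. *)

(* Defs.v *)
From mathcomp Require Export all_boot all_order all_algebra.
From mathcomp Require Export reals.
From mathcomp Require Export mxtens.

Set Implicit Arguments.
Unset Strict Implicit.
Unset Printing Implicit Defensive.

Import GRing.Theory.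
Local Open Scope ring_scope.

(* [mxtens_index (i, k) = i * p + k] for [i : 'I_m], [k : 'I_p], hence
   [(A *t B) (i * p + k) (j * q + l) = A i j * B k l] with 0-based indices
   ([tensmxE]): [tensmx] is the Kronecker product. *)
Notation "A *t B" := (tensmx A B)
  (at level 40, left associativity, format "A  *t  B") : ring_scope.

(* Column-major ordering of a two-dimensional array: with 0-based indices the
   entry of [vec2 x] in position [n * j + i] is [x i j]; here
   [(mxtens_unindex l).1 = l %/ n] and [(mxtens_unindex l).2 = l %% n]. *)
Definition vec2 (R : Type) (n m : nat) (x : 'I_n -> 'I_m -> R) :
    'cV[R]_(m * n) :=
  \col_l let: (j, i) := mxtens_unindex l in x i j.

(* Likewise [x i j k] is in position [n * m * k + n * j + i]. *)
Definition vec3 (R : Type) (n m p : nat) (x : 'I_n -> 'I_m -> 'I_p -> R) :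
    'cV[R]_(p * m * n) :=
  \col_l let: (kj, i) := mxtens_unindex l in
         let: (k, j) := mxtens_unindex kj in x i j k.

Lemma vec2E (R : Type) (n m : nat) (x : 'I_n -> 'I_m -> R)
    (i : 'I_n) (j : 'I_m) (l : 'I_(m * n)) :
  l = (n * j + i)%N :> nat -> vec2 x l 0 = x i j.
Proof.
move=> lE; have -> : l = mxtens_index (j, i).
  by apply: val_inj; rewrite /= lE mulnC.
by rewrite mxE mxtens_indexK.
Qed.

Lemma vec3E (R : Type) (n m p : nat) (x : 'I_n -> 'I_m -> 'I_p -> R)
    (i : 'I_n) (j : 'I_m) (k : 'I_p) (l : 'I_(p * m * n)) :
  l = (n * m * k + n * j + i)%N :> nat -> vec3 x l 0 = x i j k.
Proof.
move=> lE; have -> : l = mxtens_index (mxtens_index (k, j), i).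
  by apply: val_inj; rewrite /= lE mulnDl (mulnC j) -(mulnA k) (mulnC k) (mulnC m).
by rewrite mxE !mxtens_indexK.
Qed.

(* Main.v *)
Require Import Defs.
Import GRing.Theory.
Local Open Scope ring_scope.

(** The quadratic form of [M] at [u] is the double sum of [M l1 l2 * u l1 * u l2].
    An index [l] into a Kronecker product is the same thing as a pair [(j, i)]
    of indices into the factors ([sum_mxtens]), and along this bijection the
    entries of [B *t A] are products of entries while [vec2 x] reads off [x]; so
    the quadratic form at [vec2 x] is the stated sum up to the order of
    summation ([quad_vec2]).  For three-dimensional arrays, merging the last two
    indices into one turns [vec3] into [vec2], so the two-dimensional identity
    applied to [C *t B] and [A] leaves only the merged indices to be split
    again ([quad_vec3]). *)

Lemma sum_mxtens (V : nmodType) (m n : nat) (F : 'I_(m * n) -> V) :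
  \sum_l F l = \sum_j \sum_i F (mxtens_index (j, i)).
Proof.
rewrite pair_bigA /= (reindex (@mxtens_index m n)) /=.
  by apply: eq_bigr => -[].
by exists (@mxtens_unindex m n) => l _; rewrite ?mxtens_indexK ?mxtens_unindexK.
Qed.

Lemma quadE (R : comNzRingType) (n : nat) (M : 'M[R]_n) (u : 'cV[R]_n) :
  (u^T *m M *m u) 0 0 = \sum_l1 \sum_l2 M l1 l2 * u l1 0 * u l2 0.
Proof.
rewrite mxE exchange_big; apply: eq_bigr => l2 _ /=.
rewrite mxE mulr_suml; apply: eq_bigr => l1 _.
by rewrite mxE [u l1 0 * _]mulrC.
Qed.

Lemma quad_vec2 (R : comNzRingType) (n m : nat) (A : 'M[R]_n) (B : 'M[R]_m)
    (x : 'I_n -> 'I_m -> R) :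
  ((vec2 x)^T *m (B *t A) *m vec2 x) 0 0 =
  \sum_i1 \sum_i2 \sum_j1 \sum_j2 A i1 i2 * B j1 j2 * x i1 j1 * x i2 j2.
Proof.
rewrite quadE sum_mxtens exchange_big; apply: eq_bigr => i1 _ /=.
rewrite [RHS]exchange_big; apply: eq_bigr => j1 _ /=.
rewrite sum_mxtens exchange_big; apply: eq_bigr => i2 _ /=.
apply: eq_bigr => j2 _.
by rewrite tensmxE !mxE !mxtens_indexK [B _ _ * _]mulrC.
Qed.

(** Both orderings let [i] vary fastest, and [vec3] orders the pairs [(k, j)]
    exactly as [mxtens_index] does. *)
Lemma vec3_vec2 (R : Type) (n m p : nat) (x : 'I_n -> 'I_m -> 'I_p -> R) :
  vec3 x = vec2 (fun i (kj : 'I_(p * m)) =>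
    x i (mxtens_unindex kj).2 (mxtens_unindex kj).1).
Proof.
apply/colP => l; rewrite !mxE.
by case: (mxtens_unindex l) => kj i; case: (mxtens_unindex kj).
Qed.

Lemma quad_vec3 (R : comNzRingType) (n m p : nat)
    (A : 'M[R]_n) (B : 'M[R]_m) (C : 'M[R]_p) (x : 'I_n -> 'I_m -> 'I_p -> R) :
  ((vec3 x)^T *m (C *t B *t A) *m vec3 x) 0 0 =
  \sum_i1 \sum_i2 \sum_j1 \sum_j2 \sum_k1 \sum_k2
    A i1 i2 * B j1 j2 * C k1 k2 * x i1 j1 k1 * x i2 j2 k2.
Proof.
(* Naming the merged array keeps simplification from unfolding
   [mxtens_unindex] into a Euclidean division before [yE] can apply. *)
rewrite vec3_vec2; set y := (fun i kj => _).
have yE i j k : y i (mxtens_index (k, j)) = x i j k.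
  by rewrite /y mxtens_indexK.
rewrite quad_vec2.
apply: eq_bigr => i1 _; apply: eq_bigr => i2 _.
rewrite sum_mxtens exchange_big; apply: eq_bigr => j1 _ /=.
rewrite [RHS]exchange_big; apply: eq_bigr => k1 _ /=.
rewrite sum_mxtens exchange_big; apply: eq_bigr => j2 _ /=.
apply: eq_bigr => k2 _.
by rewrite tensmxE !yE [C _ _ * _]mulrC mulrA.
Qed.

Theorem mainTheorem1 (R : realType) (n m p : nat)
    (A : 'M[R]_n) (B : 'M[R]_m) (C : 'M[R]_p)
    (hA : A \is symmetricmx) (hB : B \is symmetricmx) (hC : C \is symmetricmx) :
  (forall x : 'I_n -> 'I_m -> R,
     \sum_(i1 < n) \sum_(i2 < n) \sum_(j1 < m) \sum_(j2 < m)
       A i1 i2 * B j1 j2 * x i1 j1 * x i2 j2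
     = ((vec2 x)^T *m (B *t A) *m vec2 x) 0 0)
  /\
  (forall x : 'I_n -> 'I_m -> 'I_p -> R,
     \sum_(i1 < n) \sum_(i2 < n) \sum_(j1 < m) \sum_(j2 < m)
       \sum_(k1 < p) \sum_(k2 < p)
       A i1 i2 * B j1 j2 * C k1 k2 * x i1 j1 k1 * x i2 j2 k2
     = ((vec3 x)^T *m (C *t B *t A) *m vec3 x) 0 0).
Proof. by split=> x; rewrite ?quad_vec2 ?quad_vec3. Qed.
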